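(* The following topological spaces are $\omega$-sequential: (i) every sequential paracompact space; (ii) every sequential Lindelöf space; (iii) every Hausdorff second countable space.
   Context: A subset $U$ of a topological space $X$ is sequentially open if every sequence converging to a point of $U$ is eventually in $U$; a subset is sequentially closed if its complement is sequentially open; $X$ is sequential if every sequentially open subset is open. A proper sequence in $X$ is a sequence $s:\mathbb{N}\to X$ such that $s^{-1}(K)$ is finite for every closed compact $K\subset X$. A subset $C\subset X$ is s-compact if it is sequentially closed and every proper sequence in $X$ is eventually in $X\setminus C$. $X$ is $\omega$-sequential if it is sequential and its s-compact subsets are exactly its closed compact subsets. *)

(* Defs.v *)
From mathcomp Require Import all_boot all_classical topology.
Set Implicit Arguments.
Unset Strict Implicit.
Unset Printing Implicit Defensive.
Local Open Scope classical_set_scope.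

Section SequentialSpaces.
Variable X : topologicalType.
Implicit Types (s : nat -> X) (C K U A W : set X) (F G : set (set X)).

Definition sequentially_open U :=
  forall s (x : X), U x -> s n @[n --> \oo] --> x -> \forall n \near \oo, U (s n).

Definition sequentially_closed C := sequentially_open (~` C).

Definition sequential_space := forall U, sequentially_open U -> open U.

Definition proper_sequence s :=
  forall K, closed K -> compact K -> finite_set (s @^-1` K).

Definition s_compact C :=
  sequentially_closed C /\
  forall s, proper_sequence s -> \forall n \near \oo, (~` C) (s n).

Definition omega_sequential :=
  sequential_space /\ forall C, s_compact C <-> closed C /\ compact C.

Definition open_cover F := F `<=` open /\ \bigcup_(A in F) A = setT.

Definition locally_finite F :=
  forall x : X, exists2 W, nbhs x W & finite_set [set A | F A /\ A `&` W !=set0].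

Definition refines G F := forall A, G A -> exists2 B, F B & A `<=` B.

(* Neither paracompactness nor the Lindelof property includes a separation
   axiom. *)
Definition paracompact := forall F, open_cover F ->
  exists G, [/\ open_cover G, refines G F & locally_finite G].

Definition lindelof := forall F, open_cover F ->
  exists G, [/\ G `<=` F, countable G & open_cover G].

End SequentialSpaces.

Arguments sequential_space : clear implicits.
Arguments omega_sequential : clear implicits.
Arguments paracompact : clear implicits.
Arguments lindelof : clear implicits.

(* Main.v *)
Require Import Defs.
From mathcomp Require Import all_boot finmap all_classical topology.

(** In a sequential space a closed compact set is always s-compact, and an
    s-compact set is always closed, so in each case the content is that an
    s-compact set [C] is compact.  A sequence in [C] is never eventually outside
    [C], hence it is not proper: it visits some closed compact set infinitely
    often, and compactness of that set makes the sequence accumulate at a point,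
    which lies in [C] because [C] is closed ([s_compact_countably_compact]).
    So s-compact sets are countably compact, and what remains is the classical
    fact that closed countably compact subsets of paracompact or of Lindelof
    spaces are compact:
    - in a paracompact space, a locally finite family has only finitely many
      members meeting [C], for otherwise points of [C] picked in infinitely many
      distinct members would accumulate at a point violating local finiteness
      ([locally_finite_meet]);
    - in a Lindelof space, a countable cover without finite subcover yields a
      sequence in [C] whose [n]-th term avoids the first [n] members, and the
      member containing an accumulation point gives a contradiction.
    A second countable space is sequential, by choosing points outside a set in
    ever smaller basic neighborhoods, and Lindelof, so the third case is an
    instance of the second. *)

Set Implicit Arguments.
Unset Strict Implicit.
Unset Printing Implicit Defensive.
Local Open Scope classical_set_scope.

Section CountableCompactness.
Variable X : topologicalType.
Implicit Types (s : nat -> X) (C K U A W : set X) (F G : set (set X)).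

(** Countable compactness in its omega-accumulation form: repetitions in [s]
    count, which is why the condition bears on indices. *)
Definition countably_compact C := forall s, (forall n, C (s n)) ->
  exists2 x, C x & forall W, nbhs x W -> infinite_set (s @^-1` W).

Lemma sequentially_closed_closed C :
  sequential_space X -> sequentially_closed C -> closed C.
Proof. by move=> seqX /seqX; rewrite openC. Qed.

Lemma closed_compact_s_compact C : closed C -> compact C -> s_compact C.
Proof.
move=> clC cC; split=> [s x Cx sx|s /(_ _ clC cC)/finite_fsetP[D sD]].
  by apply: sx; apply: open_nbhs_nbhs; split=> //; rewrite openC.
have [N ltN] : exists N, forall n, C (s n) -> (n < N)%N.
  exists (\max_(i <- enum_fset D) i).+1 => n Cn; rewrite ltnS.
  by apply: leq_bigmax_seq => //; have : (s @^-1` C) n by []; rewrite sD.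
by exists N => // n /= Nn /ltN; rewrite ltnNge Nn.
Qed.

(** The filter used is the cofinite filter on the infinite set of times at which
    [s] is in [K], pushed forward by [s]. *)
Lemma compact_accumulation K s : compact K -> infinite_set (s @^-1` K) ->
  exists2 x, K x & forall W, nbhs x W -> infinite_set (s @^-1` W).
Proof.
move=> cK infK.
pose H := within (s @^-1` K) (@frechet_filter nat).
have finHP A : (s @ H) A <-> finite_set (s @^-1` K `\` s @^-1` A).
  suff <- : ~` [set n | K (s n) -> A (s n)] = s @^-1` K `\` s @^-1` A by [].
  by apply/seteqP; split=> n /=; [move=> /not_implyP | move=> /not_implyP].
have PH : ProperFilter (s @ H).
  constructor; last exact: fmap_filter.
  by move=> /finHP; rewrite preimage_set0 setD0.
have /cK[x [Kx clx]] : (s @ H) K by apply/finHP; rewrite setDv.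
exists x => // W xW finW.
have HW : (s @ H) (~` W).
  by apply/finHP; apply: sub_finite_set finW => n [_ /= /contrapT].
by have [y []] := clx _ _ HW xW.
Qed.

Lemma s_compact_countably_compact C :
  closed C -> s_compact C -> countably_compact C.
Proof.
move=> clC [_ properC] s Cs.
have /existsNP[K /not_implyP[clK /not_implyP[cK infK]]] : ~ proper_sequence s.
  by move=> /properC/filter_ex[n]; apply.
have [||x [_ Cx] accx] := @compact_accumulation (K `&` C) s.
- exact: compact_closedI.
- by apply: contra_not infK; apply: sub_finite_set => n Kn; split=> //; exact: Cs.
- by exists x.
Qed.

(** A filter on [C] without cluster point in [C] yields an open cover by sets
    whose complements are in the filter; no finite union of them covers [C]. *)
Lemma compact_finite_subcover C :
  (forall F, F `<=` open -> C `<=` \bigcup_(A in F) A ->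
     exists G, [/\ finite_set G, G `<=` F & C `<=` \bigcup_(A in G) A]) ->
  compact C.
Proof.
move=> fincov H PH HC; apply: contrapT => noclu.
have [|x Cx|G [finG GF CG]] := fincov [set U | open U /\ H (~` U)].
- by move=> U [].
- have /existsNP[A /existsNP[B /not_implyP[HA /not_implyP[xB AB0]]]] :
    ~ cluster H x by move=> clux; apply: noclu; exists x.
  exists (interior B) => //=; split; first exact: open_interior.
  apply: filterS HA => y Ay /interior_subset By.
  by apply: AB0; exists y.
- have /finite_fsetP[D GD] := finG.
  have HD : H (\bigcap_(U in [set` D]) ~` U).
    apply: filter_bigI => U UD.
    by have /GF[] : G U by rewrite GD.
  have [y [Cy Dy]] := filter_ex (filterI HC HD).
  by have [U GU Uy] := CG y Cy; apply: (Dy U) => //; rewrite -GD.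
Qed.

(** Adding the complement of a closed set turns a cover of that set into a cover
    of the space. *)
Lemma open_cover_setC C F : closed C -> F `<=` open ->
  C `<=` \bigcup_(A in F) A -> open_cover (F `|` [set ~` C]).
Proof.
move=> clC Fop CF; split=> [A [/Fop//|->]|]; first by rewrite /= openC.
rewrite -subTset => x _; have [/CF[A FA Ax]|nCx] := pselect (C x).
- by exists A => //; left.
- by exists (~` C) => //; right.
Qed.

Lemma locally_finite_meet C G : countably_compact C -> locally_finite G ->
  finite_set [set A | G A /\ A `&` C !=set0].
Proof.
move=> cC lfG; apply: contrapT => /infiniteP/pcard_leP[a].
have aG n : G (a n) /\ a n `&` C !=set0 by exact: (@funS _ _ _ _ a n I).
have /choice[s sP] : forall n, exists x, (a n `&` C) x by move=> n; case: (aG n).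
have [|x _ accx] := cC s; first by move=> n; case: (sP n).
have [W xW finW] := lfG x.
apply: (accx W xW).
(* Distinct times in [W] give distinct members of [G] meeting [W]. *)
apply: (@sub_finite_set _ _ (a @^-1` [set A | G A /\ A `&` W !=set0])).
  move=> n Wn; split; first by case: (aG n).
  by exists (s n); split=> //; case: (sP n).
apply: finite_preimage finW => m n _ _.
by apply: (@inj _ _ _ a); rewrite inE.
Qed.

Lemma paracompact_countably_compact C :
  paracompact X -> closed C -> countably_compact C -> compact C.
Proof.
move=> pX clC cC; apply: compact_finite_subcover => F Fop CF.
have [G [[_ Gcov] GF lfG]] := pX _ (open_cover_setC clC Fop CF).
pose M := [set A | G A /\ A `&` C !=set0].
have finM : finite_set M by exact: locally_finite_meet.
(* A member of [G] meeting [C] cannot be contained in the added [~` C]. *)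
have /choice[h hP] : forall A, exists B, M A -> F B /\ A `<=` B.
  move=> A; have [[GA [x [Ax Cx]]]|nMA] := pselect (M A); last by exists set0.
  have [B [FB|->] AB] := GF A GA; first by exists B.
  by have := AB x Ax Cx.
exists (h @` M); split; first exact: finite_image.
- by move=> _ [A /hP[FA _] <-].
- move=> x Cx; have [A GA Ax] : (\bigcup_(A in G) A) x by rewrite Gcov.
  have MA : M A by split=> //; exists x.
  by exists (h A); [exists A | apply: (hP A MA).2].
Qed.

Lemma lindelof_countably_compact C :
  lindelof X -> closed C -> countably_compact C -> compact C.
Proof.
move=> lX clC cC; apply: compact_finite_subcover => F Fop CF.
have [G [GF /pcard_surjP[e eG] [_ Gcov]]] := lX _ (open_cover_setC clC Fop CF).
(* [e] enumerates [G], possibly among other sets, so membership in [F] is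
   imposed on the first values of [e]. *)
pose first n := F `&` e @` [set i | (i < n)%N].
apply: contrapT => nofin.
have /choice[s sP] : forall n, exists x, C x /\ ~ (\bigcup_(A in first n) A) x.
  move=> n; apply: contrapT => /forallNP sub; apply: nofin.
  exists (first n); split.
  - by apply: finite_setIr; apply: finite_image; exact: finite_II.
  - by move=> A [].
  - by move=> x Cx; apply: contrapT => nx; apply: (sub x).
have [|x Cx accx] := cC s; first by move=> n; case: (sP n).
have [A GA Ax] : (\bigcup_(A in G) A) x by rewrite Gcov.
have FA : F A by have [//|eqA] := GF A GA; move: Ax; rewrite eqA.
have [m _ emA] := eG A GA.
have Anx : nbhs x A by apply: open_nbhs_nbhs; split=> //; exact: Fop.
apply: (accx A Anx); apply: (sub_finite_set _ (finite_II m.+1)) => n /= An.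
rewrite ltnNge; apply/negP => mn.
by case: (sP n) => _; apply; exists A => //; split=> //; exists m.
Qed.

Lemma omega_sequential_countably_compact : sequential_space X ->
  (forall C, closed C -> countably_compact C -> compact C) ->
  omega_sequential X.
Proof.
move=> seqX cptX; split=> // C; split=> [sC|[]]; last exact: closed_compact_s_compact.
have clC : closed C by apply: sequentially_closed_closed => //; case: sC.
by split=> //; apply: cptX => //; exact: s_compact_countably_compact.
Qed.

Lemma second_countable_lindelof : @second_countable X -> lindelof X.
Proof.
move=> [B ctB [_ Bbase]] F [Fop Fcov].
pose small := [set V | B V /\ exists2 A, F A & V `<=` A].
have /choice[h hP] : forall V, exists A, small V -> F A /\ V `<=` A.
  move=> V; have [[_ [A FA VA]]|nV] := pselect (small V); last by exists set0.
  by exists A.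
exists (h @` small).
have hF : h @` small `<=` F by move=> _ [V /hP[FV _] <-].
split=> //.
  apply: sub_countable (card_image_le _ _) _.
  by apply: sub_countable ctB; apply: subset_card_le => V [].
split; first by move=> A /hF/Fop.
rewrite -subTset => x _.
have [A FA Ax] : (\bigcup_(A in F) A) x by rewrite Fcov.
have [|V [BV Vx] VA] := Bbase x A.
  by apply: open_nbhs_nbhs; split=> //; exact: Fop.
have sV : small V by split=> //; exists A.
by exists (h V); [exists V | apply: (hP V sV).2].
Qed.

(** If [U] is not a neighborhood of [x], then points outside [U] chosen in the
    intersections of the first basic neighborhoods of [x] converge to [x]. *)
Lemma second_countable_sequential : @second_countable X -> sequential_space X.
Proof.
move=> [B /pcard_surjP[e eB] [Bop Bbase]] U seqU.
rewrite openE => x Ux; apply: contrapT => nxU.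
have /choice[s sP] : forall n, exists y,
    (forall i : 'I_n, nbhs x (e i) -> e i y) /\ ~ U y.
  move=> n; apply: contrapT => /forallNP sub; apply: nxU.
  have : \forall y \near x, forall i : 'I_n, nbhs x (e i) -> e i y.
    apply: filter_forall => i.
    have [xi|nxi] := pselect (nbhs x (e i)); first by apply: filterS xi.
    exact: nearW.
  by apply: filterS => y ey; apply: contrapT => nUy; apply: (sub y).
have sx : s n @[n --> \oo] --> x.
  move=> W /Bbase[V [BV Vx] VW].
  have [m _ emA] := eB V BV.
  have xV : nbhs x (e m).
    by rewrite emA; apply: open_nbhs_nbhs; split=> //; exact: Bop.
  exists m.+1 => // n /= mn; apply: VW; rewrite /= -emA.
  by case: (sP n) => /(_ (Ordinal mn)) + _; apply.
by have /filter_ex[n] := seqU s x Ux sx; case: (sP n).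
Qed.

End CountableCompactness.

Theorem proposition3p12 :
  [/\ forall X : topologicalType,
        sequential_space X -> paracompact X -> omega_sequential X,
      forall X : topologicalType,
        sequential_space X -> lindelof X -> omega_sequential X &
      forall X : topologicalType,
        hausdorff_space X -> @second_countable X -> omega_sequential X].
Proof.
have lindelofP X : sequential_space X -> lindelof X -> omega_sequential X.
  move=> seqX lX; apply: omega_sequential_countably_compact => // C.
  exact: lindelof_countably_compact.
split=> [X seqX pX|//|X _ scX].
- apply: omega_sequential_countably_compact => // C.
  exact: paracompact_countably_compact.
- by apply: lindelofP;
    [exact: second_countable_sequential | exact: second_countable_lindelof].
Qed.
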